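(* Let $\mathcal D\subset\Omega\subset\mathbb R^d$, $T>0$, $\varepsilon>0$. For $t\in[0,T]$ and $\mathbf x\in\mathcal D$ let $\bar E$ and $\hat E$ (both depending on $t,\mathbf x$) be the events that the processes $\bar X$ and $\hat X$, respectively, stay inside $\Omega$ till time $t$ after starting at $\mathbf x$, where $$d\bar X_t=(\sigma^2\nabla\log p_\infty-\mu)(\bar X_t)\,dt+\sigma\,dW_t,\qquad d\hat X_t=(\sigma^2\nabla\log\hat p_\infty-\mu)(\hat X_t)\,dt+\sigma\,dW_t .$$ Put $h_0=\dfrac{p_0}{p_\infty}$ and $\hat h_0=\dfrac{p_0}{\hat p_\infty}$. Assume: 1. $\xi(T,\mathcal D,\Omega)>1-\varepsilon$, where $$\xi(T,\mathcal D,\Omega)=\mathbb E_{\mathbf x\sim U(\mathcal D)}\big[P(\bar X_t\in\Omega\ \forall\,t\in[0,T]\mid\bar X_0=\mathbf x)\big].$$ 2. There exists a constant $K>0$ such that for all $(t,\mathbf x)\in[0,T]\times\mathcal D$, $$p_\infty(\mathbf x)\,\mathbb E[h_0(\bar X_t)\mid\bar X_0=\mathbf x,\bar E^c]<K\quad\text{and}\quad \hat p_\infty(\mathbf x)\,\mathbb E[\hat h_0(\hat X_t)\mid\hat X_0=\mathbf x,\hat E^c]<K .$$ Then $$\mathbb E_{\mathbf x\sim U(\mathcal D)}\big[|\hat p(t,\mathbf x)-p(t,\mathbf x)|\big]<2K\varepsilon\qquad\forall\,t\in[0,T].$$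
   Context: Let $\mu\in C^1(\mathbb R^d;\mathbb R^d)$, let $\sigma>0$ be a constant scalar (diffusion matrix $\sigma I_d$), and let $p_0$ be a probability density on $\mathbb R^d$. The Fokker-Planck operator is $\mathcal L f=-\nabla\cdot(\mu f)+\frac{\sigma^2}{2}\Delta f$. $W_t$ is a standard $d$-dimensional Brownian motion. $p_\infty>0$ is a zero of $\mathcal L$ on $\mathbb R^d$, i.e. $\mathcal Lp_\infty=0$ (not necessarily normalized). It is known perfectly only on $\Omega$: define $$\hat p_\infty(\mathbf x)=\begin{cases}p_\infty(\mathbf x),&\mathbf x\in\Omega,\\ p_\infty^\sharp(\mathbf x),&\mathbf x\in\Omega^c,\end{cases}$$ where $p_\infty^\sharp>0$, $p_\infty^\sharp\ne p_\infty$, represents imperfect knowledge of $p_\infty$ outside $\Omega$. $\mathcal D$ and $\Omega$ are bounded domains, and $U(\mathcal D)$ denotes the uniform distribution on $\mathcal D$. It is assumed throughout that the two SDEs for $\bar X$ and $\hat X$ have well-defined solutions (unique in law) for each starting point in $\mathcal D$ up to time $T$, that the two processes follow identical dynamics inside $\Omega$ (so that $P(\bar E)=P(\hat E)$), and that the expectations below are finite. The solution $p$ of the Fokker-Planck equation $\frac{\partial p}{\partial t}=\mathcal Lp$, $p(0,\cdot)=p_0$, is the one given by the Feynman-Kac representation $$p(t,\mathbf x)=p_\infty(\mathbf x)\,\mathbb E\Big[\frac{p_0(\bar X_t)}{p_\infty(\bar X_t)}\,\Big|\,\bar X_0=\mathbf x\Big],$$ and the approximate solution is $$\hat p(t,\mathbf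 x)=\hat p_\infty(\mathbf x)\,\mathbb E\Big[\frac{p_0(\hat X_t)}{\hat p_\infty(\hat X_t)}\,\Big|\,\hat X_0=\mathbf x\Big].$$ Conditional expectations given $\bar E^c$ or $\hat E^c$ are only required to satisfy the bound when the conditioning event has positive probability. *)

(* Defs.v *)
From HB Require Import structures.
From mathcomp Require Import all_boot all_order all_algebra.
From mathcomp Require Import all_classical all_reals all_analysis.

Set Implicit Arguments.
Unset Strict Implicit.
Unset Printing Implicit Defensive.

Import Order.TTheory GRing.Theory Num.Theory.
Import numFieldNormedType.Exports.

Local Open Scope classical_set_scope.
Local Open Scope ring_scope.

Definition measure_rV_display : measure_display. Proof. exact. Qed.

Section measurable_rV.
Context {R : realType} (n : nat).

(* The product sigma-algebra generated by the coordinates; it is the Borel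
   sigma-algebra because [R] is second countable. *)
Let coor (i : 'I_n) (x : 'rV[R]_n) : R := x ord0 i.

Let rV_set0 : g_sigma_preimage coor set0.
Proof. exact: sigma_algebra0. Qed.

Let rV_setC A : g_sigma_preimage coor A -> g_sigma_preimage coor (~` A).
Proof. exact: sigma_algebraC. Qed.

Let rV_bigcup (F : (set 'rV[R]_n)^nat) :
  (forall i, g_sigma_preimage coor (F i)) ->
  g_sigma_preimage coor (\bigcup_i (F i)).
Proof. exact: sigma_algebra_bigcup. Qed.

HB.instance Definition _ := @isMeasurable.Build measure_rV_display
  'rV[R]_n (g_sigma_preimage coor) rV_set0 rV_setC rV_bigcup.

Lemma measurable_coor (i : 'I_n) :
  measurable_fun [set: 'rV[R]_n] (fun x => x ord0 i).
Proof.
move=> _ Y mY; rewrite setTI; apply: sub_sigma_algebra => /=.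
rewrite -bigcup_seq/=; exists i => /=; first by rewrite mem_index_enum.
by exists Y => //; rewrite setTI.
Qed.

Lemma measurable_fun_rVP d (T : measurableType d) (f : T -> 'rV[R]_n) :
  measurable_fun [set: T] f <->
  forall i, measurable_fun [set: T] (fun x => f x ord0 i).
Proof.
split=> [mf i|mf].
  by apply: (measurableT_comp (measurable_coor i)).
apply: (@measurability _ _ _ _ setT f
  (\big[setU/set0]_(i < n) preimage_set_system setT (coor i) measurable)) => //.
move=> _ [B + <-]; rewrite -bigcup_seq => -[i _ [C mC <-]].
by rewrite !setTI -comp_preimage -[X in measurable X]setTI; exact: mf.
Qed.

End measurable_rV.

Section lebesgue_rV.
Context {R : realType}.

Definition cons_rV n (p : measurableTypeR R * 'rV[R]_n) : 'rV[R]_n.+1 :=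
  row_mx (const_mx p.1 : 'rV[R]_1) p.2.

Lemma measurable_cons_rV n : measurable_fun [set: _] (@cons_rV n).
Proof.
apply/measurable_fun_rVP => i; rewrite /cons_rV.
rewrite (_ : (fun _ => _) = fun x : measurableTypeR R * 'rV[R]_n =>
    match fintype.split (i : 'I_(1 + n)) with
    | inl _ => x.1 | inr k => x.2 ord0 k end).
  case: (fintype.split _) => k /=; first exact: measurable_fst.
  exact: (measurableT_comp (measurable_coor k) measurable_snd).
by apply/funext => x; rewrite mxE; case: (fintype.split _) => k //; rewrite mxE.
Qed.

Section step.
Variables (n : nat) (m : {sigma_finite_measure set 'rV[R]_n -> \bar R}).

Let mu : set 'rV[R]_n.+1 -> \bar R :=
  pushforward (@lebesgue_measure R \x m)%E (@cons_rV n).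

Let mu0 : mu set0 = 0%E.
Proof. by rewrite /mu /pushforward preimage_set0 measure0. Qed.

Let mu_ge0 A : (0 <= mu A)%E.
Proof. by rewrite /mu /pushforward; exact: measure_ge0. Qed.

Let mu_sigma_additive : semi_sigma_additive mu.
Proof.
move=> F mF tF mUF; rewrite /mu /pushforward preimage_bigcup.
have mcF k : measurable (@cons_rV n @^-1` F k).
  by rewrite -[X in measurable X]setTI; exact: measurable_cons_rV.
apply: measure_semi_sigma_additive => //; last first.
  by apply: bigcup_measurable => k _; exact: mcF.
apply/trivIsetP => /= i j _ _ ij; rewrite -preimage_setI.
by move/trivIsetP : tF => /(_ _ _ _ _ ij) ->//; rewrite preimage_set0.
Qed.

Definition lebesgue_rV_step := mu.

HB.instance Definition _ := isMeasure.Build _ _ _ lebesgue_rV_step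
  mu0 mu_ge0 mu_sigma_additive.

Let mu_sigma_finite : sigma_finite setT mu.
Proof.
have /sigma_finiteP[F [TF ndF Foo]] := sigma_finiteT (@lebesgue_measure R).
have /sigma_finiteP[G [TG ndG Goo]] := sigma_finiteT m.
pose g (v : 'rV[R]_n.+1) : measurableTypeR R * 'rV[R]_n :=
  (v ord0 ord0, rsubmx (v : 'rV_(1 + n))).
have mg : measurable_fun [set: _] g.
  apply: measurable_fun_pair; first exact: measurable_coor.
  apply/measurable_fun_rVP => i; rewrite (_ : (fun _ => _) =
    fun v : 'rV[R]_n.+1 => v ord0 (rshift 1 i)); first exact: measurable_coor.
  by apply/funext => v; rewrite mxE.
have gK p : g (cons_rV p) = p.
  case: p => a v; rewrite /g /cons_rV row_mxKr /=; congr pair.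
  by rewrite mxE; case: splitP => // j _; rewrite mxE.
exists (fun k => g @^-1` (F k `*` G k)).
  apply/esym/seteqP; split=> // v _ /=.
  have [k _ Fk] : (\bigcup_k F k) (g v).1 by rewrite -TF.
  have [l _ Gl] : (\bigcup_k G k) (g v).2 by rewrite -TG.
  exists (maxn k l) => //; split.
  - by move: Fk; exact/subsetPset/ndF/leq_maxl.
  - by move: Gl; exact/subsetPset/ndG/leq_maxr.
move=> k; have [mFk Fkoo] := Foo k; have [mGk Gkoo] := Goo k; split.
  by rewrite -[X in measurable X]setTI; apply: mg => //; exact: measurableX.
rewrite /mu /pushforward (_ : _ @^-1` _ = F k `*` G k); last first.
  by apply/seteqP; split => p; rewrite /preimage /mkset gK.
by rewrite product_measure1E// lte_mul_pinfty// ge0_fin_numE.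
Qed.

HB.instance Definition _ := Measure_isSigmaFinite.Build _ _ _ lebesgue_rV_step
  mu_sigma_finite.

End step.

(* [R^0] is a point, of measure 1, and [R^n.+1] is identified with
   [R * R^n]. *)
Fixpoint lebesgue_rV n : {sigma_finite_measure set 'rV[R]_n -> \bar R} :=
  match n with
  | 0 => [the {sigma_finite_measure set 'rV[R]_0 -> \bar R} of
           dirac (0 : 'rV[R]_0)]
  | k.+1 => [the {sigma_finite_measure set 'rV[R]_k.+1 -> \bar R} of
              lebesgue_rV_step (lebesgue_rV k)]
  end.

End lebesgue_rV.

Section differential_operators.
Context {R : realType} {d : nat}.
Implicit Types (f q : 'rV[R]_d -> R) (mu : 'rV[R]_d -> 'rV[R]_d).

Definition pderiv (i : 'I_d) f : 'rV[R]_d -> R :=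
  fun x => 'D_(delta_mx ord0 i) f x.

Definition gradient f (x : 'rV[R]_d) : 'rV[R]_d := \row_i pderiv i f x.

Definition divergence mu (x : 'rV[R]_d) : R :=
  \sum_(i < d) pderiv i (fun y => mu y ord0 i) x.

Definition laplacian f (x : 'rV[R]_d) : R :=
  \sum_(i < d) pderiv i (pderiv i f) x.

Definition is_C1 f := forall i : 'I_d,
  (forall x, derivable f x (delta_mx ord0 i)) /\ continuous (pderiv i f).

Definition is_C2 f := is_C1 f /\ forall i, is_C1 (pderiv i f).

Definition is_C1_field mu := forall i, is_C1 (fun x => mu x ord0 i).

Definition fokker_planck mu (sigma : R) f (x : 'rV[R]_d) : R :=
  - divergence (fun y => f y *: mu y) x + sigma ^+ 2 / 2 * laplacian f x.

(* The drift [sigma^2 grad (log q) - mu].  Where [log q] is not differentiable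
   (typically on the boundary of the set outside of which [q] is imperfectly
   known), ['D_v] is total and the value of the drift is unspecified. *)
Definition fk_drift mu (sigma : R) q (x : 'rV[R]_d) : 'rV[R]_d :=
  sigma ^+ 2 *: gradient (fun y => ln (q y)) x - mu x.

End differential_operators.

Definition bounded_domain {R : realType} {d : nat} (A : set 'rV[R]_d) :=
  [/\ open A, A !=set0, connected A & bounded_set A].

Definition is_density {R : realType} {d : nat} (p0 : 'rV[R]_d -> R) :=
  [/\ measurable_fun [set: 'rV[R]_d] p0, (forall x, 0 <= p0 x) &
      (\int[lebesgue_rV d]_x (p0 x)%:E = 1)%E].

Definition uniform_expectation {R : realType} {d : nat} (D : set 'rV[R]_d)
    (f : 'rV[R]_d -> \bar R) : \bar R :=
  ((\int[lebesgue_rV d]_(x in D) f x) / lebesgue_rV d D)%E.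

Section stochastic_processes.
Context {R : realType} {d : nat} {dS : measure_display} {S : measurableType dS}.
Implicit Types (P : probability S R) (F : R -> set (set S)).
Implicit Types W X : R -> S -> 'rV[R]_d.

(* [E[Z | A]]; only meaningful when [P A] is positive. *)
Definition event_expectation P (A : set S) (Z : S -> R) : \bar R :=
  ((\int[P]_(w in A) (Z w)%:E) / P A)%E.

Definition filtration F :=
  [/\ forall t, 0 <= t -> sigma_algebra [set: S] (F t),
      forall t, 0 <= t -> F t `<=` measurable &
      forall s t, 0 <= s -> s <= t -> F s `<=` F t].

Definition adapted F (I : set R) X := forall t, I t ->
  forall A : set 'rV[R]_d, measurable A -> F t (X t @^-1` A).

(* The last clause says that for [s < t] the increment [W t - W s] is
   independent of [F s] with law [N(0, (t - s) I_d)]; [normal_prob] takes the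
   standard deviation. *)
Definition brownian_motion P F W :=
  [/\ {ae P, forall w, W 0 w = 0},
      forall w, {within `[0, +oo[, continuous (W ^~ w)},
      adapted F `[0, +oo[ W &
      forall s t, 0 <= s -> s < t ->
      forall B, F s B -> forall A : 'I_d -> set (measurableTypeR R),
        (forall i, measurable (A i)) ->
        P (B `&` [set w | forall i, A i (W t w ord0 i - W s w ord0 i)]) =
        (P B * \prod_(i < d) normal_prob 0%R (Num.sqrt (t - s)%R) (A i))%E].

(* [X] solves [dX = b(X) dt + sigma dW] on [[0, T]] with [X_0 = x]; as the
   diffusion coefficient is constant, [\int_0^t sigma dW = sigma (W_t - W_0)]
   and the integral equation holds path by path. *)
Definition sde_solution P (T : R) (b : 'rV[R]_d -> 'rV[R]_d) (sigma : R)
    (x : 'rV[R]_d) W X :=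
  exists F, [/\ filtration F, brownian_motion P F W,
    adapted F `[0, T] X,
    forall w, {within `[0, T], continuous (X ^~ w)} &
    {ae P, forall w, [/\ X 0 w = x,
      forall i, (@lebesgue_measure R).-integrable `[0, T]
                  (fun s => (b (X s w) ord0 i)%:E) &
      forall t, 0 <= t <= T -> forall i,
        X t w ord0 i = x ord0 i
          + \int[@lebesgue_measure R]_(s in `[0, t]) (b (X s w) ord0 i)
          + sigma * (W t w ord0 i - W 0 w ord0 i)]}].

Definition stays_in (A : set 'rV[R]_d) X (t : R) : set S :=
  [set w | forall s, 0 <= s <= t -> A (X s w)].

(* [P] is meant to be a law under which [X_0 = x]. *)
Definition feynman_kac P (q p0 : 'rV[R]_d -> R) X (t : R) (x : 'rV[R]_d)
    : \bar R :=
  ((q x)%:E * 'E_P[fun w => (p0 (X t w) / q (X t w))%R])%E.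

End stochastic_processes.

Definition unique_in_law {R : realType} {d : nat} (T : R)
    (b : 'rV[R]_d -> 'rV[R]_d) (sigma : R) (x : 'rV[R]_d) :=
  forall (d1 : measure_display) (S1 : measurableType d1)
    (P1 : probability S1 R) (W1 X1 : R -> S1 -> 'rV[R]_d)
    (d2 : measure_display) (S2 : measurableType d2)
    (P2 : probability S2 R) (W2 X2 : R -> S2 -> 'rV[R]_d),
  sde_solution P1 T b sigma x W1 X1 -> sde_solution P2 T b sigma x W2 X2 ->
  forall (n : nat) (t : 'I_n -> R) (A : 'I_n -> set 'rV[R]_d),
    (forall k, 0 <= t k <= T) -> (forall k, measurable (A k)) ->
    P1 [set w | forall k, A k (X1 (t k) w)] =
    P2 [set w | forall k, A k (X2 (t k) w)].

(* Main.v *)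
Require Import Defs.
From HB Require Import structures.
From mathcomp Require Import all_boot all_order all_algebra.
From mathcomp Require Import all_classical all_reals all_analysis.
From mathcomp Require Import ring lra.

Set Implicit Arguments.
Unset Strict Implicit.
Unset Printing Implicit Defensive.

Import Order.TTheory GRing.Theory Num.Theory.
Import numFieldNormedType.Exports.

Local Open Scope classical_set_scope.
Local Open Scope ring_scope.

(** The two processes are driven by the same Brownian motion, so the noise
    cancels in their difference, which path by path solves an integral equation
    with the two drifts.  The drift of Xbar is C^1, hence locally Lipschitz,
    and on the open set Omega it is also the drift of Xhat.  A path of one
    process that has not left Omega is therefore also the path of the other
    ([ode_unique_while_inside], [sde_solution_unique_while_inside]): almost
    surely the events Ebar and Ehat agree and on them Xbar_t = Xhat_t.

    The parts of the two Feynman-Kac expectations carried by Ebar and Ehat are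
    then equal.  What remains of each is an expectation over the exit event; it
    lies between 0 and K times the exit probability by the second assumption,
    so that |p_hat t x - p t x| <= K P(Ebar^c) ([expectation_diff_le_exit]).
    The exit probability increases with t, and its average over D at time T is
    less than eps by the first assumption; the average of |p_hat - p| is thus at
    most K eps, which is less than 2 K eps ([uniform_expectation_lt]).

    Two points need care.  The event of staying in Omega is an uncountable
    intersection, whose measurability comes from the continuity of the paths
    ([measurable_stays_in]).  And the functions of the starting point that are
    averaged over D may fail to be measurable; the integral of a nonnegative
    function is then its lower integral, the supremum over the simple functions
    below it, which is superadditive.  This is the direction that the last step
    requires: from |p_hat - p| + K P(Ebar) <= K pointwise it yields that the
    average of |p_hat - p| plus K times the average of P(Ebar) is at most K
    ([lower_integral_superadditive]). *)

(** * Measurability of the event of staying in an open set *)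

(** An open set is the union of the countably many balls with rational centre
    and radius that it contains; in the maximum norm a ball is a finite
    intersection of preimages of intervals under the coordinates. *)
Lemma measurable_open_rV (R : realType) n (U : set 'rV[R]_n) :
  open U -> measurable U.
Proof.
move=> oU; pose q2r (q : 'rV[rat]_n) : 'rV[R]_n := map_mx ratr q.
pose B (p : 'rV[rat]_n * rat) : set 'rV[R]_n :=
  if `[< ball (q2r p.1) (ratr p.2 : R) `<=` U >] then
    ball (q2r p.1) (ratr p.2 : R) else set0.
have mball x e : measurable (ball x e : set 'rV[R]_n).
  have [e0|e0] := ltP 0 e; last first.
    rewrite (_ : ball x e = set0) //; apply/seteqP; split => // y [].
    by rewrite ltNge e0.
  rewrite (_ : ball x e =
      \bigcap_(i in [set: 'I_n]) ((fun y : 'rV[R]_n => y ord0 i) @^-1`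
         ball (x ord0 i) e)).
    apply: fin_bigcap_measurable => // i _; rewrite -[X in measurable X]setTI.
    by apply: measurable_coor => //; rewrite ball_itv; exact: measurable_itv.
  apply/seteqP; split=> [y [_ yx] i _|y yx]; first exact: yx.
  by split => // i j; rewrite (ord1 i); exact: yx.
rewrite (_ : U = \bigcup_p B p).
  apply: countable_bigcupT_measurable => //.
  by move=> p; rewrite /B; case: ifP.
apply/seteqP; split=> [y Uy|y [p _]]; last first.
  by rewrite /B; case: asboolP => // pU; exact: pU.
have [e /= e0 yeU] : nbhs_ball y U.
  by apply/nbhs_ballP; exact: (open_nbhs_nbhs (conj oU Uy)).
have [r] := @rat_in_itvoo R 0 (e / 2) (divr_gt0 e0 (ltr0Sn R 1)).
rewrite in_itv/= => /andP[r0 re].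
have /choice[q qP] (i : 'I_n) : exists q : rat, `|y ord0 i - ratr q| < ratr r.
  have [|q] := @rat_in_itvoo R (y ord0 i - ratr r) (y ord0 i + ratr r).
    by rewrite ltrD2l; lra.
  by rewrite in_itv/= => /andP[? ?]; exists q; rewrite ltr_norml; lra.
have qy : ball (q2r (\row_i q i)) (ratr r : R) y.
  split => // i j; rewrite !mxE (ord1 i) /ball/= distrC; exact: qP.
have qU : ball (q2r (\row_i q i)) (ratr r : R) `<=` U.
  apply: (subset_trans _ yeU) => z qz; rewrite (splitr e).
  by apply: (@ball_triangle _ _ (q2r (\row_i q i)));
    [apply: ball_sym; apply: le_ball qy| apply: le_ball qz]; exact: ltW.
by exists (\row_i q i, r) => //; rewrite /B /= asboolT.
Qed.

Lemma within_continuous_ball (R : realType) (V : pseudoMetricType R) (a b : R)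
    (f : R -> V) (s e : R) :
  {within `[a, b], continuous f} -> a <= s <= b -> 0 < e ->
  exists2 dl, 0 < dl & forall r, a <= r <= b -> `|s - r| < dl ->
    ball (f s) e (f r).
Proof.
move=> /subspace_continuousP cf sab e0.
have /cf/(_ _ (nbhsx_ballx (f s) e e0)) : `[a, b]%classic s by rewrite /= in_itv.
move=> /nbhs_ballP[dl /= dl0 H]; exists dl => // r rab sr.
apply: (H r) => //=; rewrite in_itv.
Qed.

(** A path on [0, t] has compact image, so it stays in [Om] exactly when it
    stays, for some k, in the closed set of points at distance at least 1/(k+1)
    from the complement of [Om]; for a closed set it is enough to look at the
    times [q * t] with [q] rational in [0, 1]. *)
Lemma measurable_stays_in (R : realType) n dS (S : measurableType dS)
    (Om : set 'rV[R]_n) (X : R -> S -> 'rV[R]_n) (t : R) : open Om -> 0 <= t ->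
  (forall s, 0 <= s <= t -> measurable_fun [set: S] (X s)) ->
  (forall w, {within `[0, t], continuous (X ^~ w)}) ->
  measurable (stays_in Om X t).
Proof.
move=> oOm t0 mX cX.
pose C k : set 'rV[R]_n := [set y | forall z, ball y k.+1%:R^-1 z -> Om z].
have mC k : measurable (C k).
  rewrite -[C k]setCK; apply: measurableC; apply: measurable_open_rV.
  rewrite (_ : ~` C k = \bigcup_(z in ~` Om) ball z k.+1%:R^-1).
    by apply: bigcup_open => z _; exact: ball_open.
  apply/seteqP; split => [y /= /existsNP[z /not_implyP[yz Oz]]|y [z Oz zy] yC].
    by exists z => //; exact: ball_sym.
  by apply/Oz/yC/ball_sym.
pose Q : set rat := [set q | 0 <= (ratr q : R) <= 1].
rewrite (_ : stays_in Om X t =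
    \bigcup_k \bigcap_(q in Q) (X (ratr q * t) @^-1` C k)).
  apply: bigcupT_measurable => k; rewrite -[X in measurable X]setCK.
  rewrite setC_bigcap bigcup_mkcond; apply: measurableC.
  apply: countable_bigcupT_measurable => // q; case: ifPn => //.
  rewrite inE => /andP[q0 q1]; apply: measurableC.
  rewrite -[X in measurable X]setTI; apply: mX => //.
  by rewrite mulr_ge0//= ler_piMl.
apply/seteqP; split => [w wE|w [k _ wk] s /andP[s0 st]].
  have : near_covering_within `[0, t]%classic.
    apply/near_covering_withinP/compact_near_coveringP.
    exact: segment_compact.
  move=> /(_ nat \oo (fun k s => C k (X s w)) _)[].
    move=> s; rewrite /= in_itv/= => st.
    have /nbhs_ballP[e /= e0 eO] : nbhs (X s w) Om.
      by apply: open_nbhs_nbhs; split => //; exact: wE.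
    have [|dl dl0 H] := within_continuous_ball (cX w) st (_ : 0 < e / 2).
      by rewrite divr_gt0.
    exists (ball s dl, [set k | k.+1%:R^-1 < e / 2]).
      split; first exact: nbhsx_ballx.
      by apply: (near_infty_natSinv_lt (PosNum (divr_gt0 e0 (ltr0Sn R 1)))).
    move=> [r k] /= [sr ke] rt z rz; apply: eO; rewrite (splitr e).
    by apply: ball_triangle (H r _ _) (le_ball (ltW ke) rz); rewrite -?in_itv.
  move=> k _ /(_ k (leqnn k)) H; exists k => // q /andP[q0 q1]; apply: H.
  by rewrite /= in_itv/= mulr_ge0//= ler_piMl.
have k0 : 0 < k.+1%:R^-1 :> R by rewrite invr_gt0.
have st0 : 0 <= s <= t by rewrite s0.
have [dl dl0 H] := within_continuous_ball (cX w) st0 k0.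
have [q q01 sq] : exists2 q : rat, 0 <= (ratr q : R) <= 1 &
    `|s - ratr q * t| < dl.
  have [tn0|tn0] := eqVneq t 0.
    have -> : s = 0 by apply/eqP; rewrite eq_le s0 andbT -tn0.
    exists 0; first by rewrite raddf0 lexx ler01.
    by rewrite tn0 mulr0 subr0 normr0.
  have tp : 0 < t by rewrite lt_neqAle eq_sym tn0.
  have sE : s = s / t * t by rewrite divfK.
  have dE : dl = dl / t * t by rewrite divfK.
  have u0 : 0 <= s / t by rewrite divr_ge0.
  have u1 : s / t <= 1 by rewrite ler_pdivrMr// mul1r.
  have v0 : 0 < dl / t by rewrite divr_gt0.
  have [|q] := @rat_in_itvoo R (Num.max 0 (s / t - dl / t))
                               (Num.min 1 (s / t + dl / t)).
    by rewrite gt_max !lt_min; apply/andP; split; apply/andP; split; lra.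
  rewrite in_itv/= gt_max lt_min => /andP[/andP[q0 q1] /andP[q2 q3]].
  exists q; first by rewrite !ltW.
  by rewrite sE dE -mulrBl normrM (gtr0_norm tp) ltr_pM2r// ltr_norml; lra.
have [q0 q1] := andP q01.
apply: (wk q q01); apply: ball_sym; apply: H => //.
by rewrite mulr_ge0//= ler_piMl.
Qed.

(** * Local Lipschitz continuity of the drift *)

Lemma coord_le_norm (R : realType) n (x : 'rV[R]_n) (i : 'I_n) :
  `|x ord0 i| <= `|x|.
Proof.
rewrite {2}/Num.norm/= mx_normrE.
exact: (le_bigmax_cond _ (fun ij : 'I_1 * 'I_n => `|x ij.1 ij.2|)
  (isT : xpredT (ord0, i))).
Qed.

Lemma norm_le_coord (R : realType) n (x : 'rV[R]_n) (a : R) : 0 <= a ->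
  (forall i, `|x ord0 i| <= a) -> `|x| <= a.
Proof.
move=> a0 xa; rewrite /Num.norm/= mx_normrE; apply: bigmax_le => // -[i j] _.
by rewrite (ord1 i); exact: xa.
Qed.

(** The difference quotients of [f] in the direction [v] are literally those of
    its restriction to a line directed by [v]. *)
Fact line_quotient (R : realType) n (f : 'rV[R]_n -> R) (v w : 'rV[R]_n)
    (h : R) :
  (fun k : R => k^-1 *: (((fun k => f (k *: v + w)) \o shift h) (k *: (1 : R))
    - f (h *: v + w))) =
  (fun k : R => k^-1 *: ((f \o shift (h *: v + w)) (k *: v) - f (h *: v + w))).
Proof. by apply/funext => k /=; rewrite [k *: 1]mulr1 scalerDl addrA. Qed.

Lemma derive_line (R : realType) n (f : 'rV[R]_n -> R) (v w : 'rV[R]_n)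
    (h : R) :
  'D_(1 : R) (fun k : R => f (k *: v + w)) h = 'D_v f (h *: v + w).
Proof. by rewrite /derive line_quotient. Qed.

Lemma is_derive_line (R : realType) n (f : 'rV[R]_n -> R) (v w : 'rV[R]_n)
    (h : R) : derivable f (h *: v + w) v ->
  is_derive h (1 : R) (fun k => f (k *: v + w)) ('D_v f (h *: v + w)).
Proof. by move=> df; split; rewrite ?derive_line// /derivable line_quotient. Qed.

Lemma line_lipschitz (R : realType) n (f : 'rV[R]_n -> R) (v w : 'rV[R]_n)
    (a L : R) : (forall x, derivable f x v) ->
  (forall h, Num.min 0 a <= h <= Num.max 0 a -> `|'D_v f (h *: v + w)| <= L) ->
  `|f (a *: v + w) - f w| <= L * `|a|.
Proof.
move=> df dL; pose g k := f (k *: v + w).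
have dg h : is_derive h (1 : R) g ('D_v f (h *: v + w)) by exact: is_derive_line.
have cg A : {within A, continuous g}.
  apply: continuous_subspaceT => h; apply: differentiable_continuous.
  by apply/derivable1_diffP; exact: ex_derive.
have g0 : g 0 = f w by rewrite /g scale0r add0r.
rewrite -/(g a) -g0; have [a0|a0] := leP 0 a.
  have [c] := MVT_segment a0 (fun h _ => dg h) (cg _).
  rewrite in_itv/= => ca ->; rewrite subr0 normrM ler_wpM2r//.
  by apply: dL; rewrite min_l// max_r.
have [c] := MVT_segment (ltW a0) (fun h _ => dg h) (cg _).
rewrite in_itv/= distrC => ca ->; rewrite sub0r normrM normrN ler_wpM2r//.
by apply: dL; rewrite (min_r (ltW a0)) (max_l (ltW a0)).
Qed.

Definition lipschitz_at (R : realType) n (f : 'rV[R]_n -> R) z :=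
  exists L r, [/\ 0 <= L, 0 < r & forall u v, ball z r u -> ball z r v ->
    `|f u - f v| <= L * `|u - v|].

(** Going from [v] to [u] by changing one coordinate at a time, each step stays
    in any ball that contains both points (a ball is a box) and is controlled by
    the mean value theorem and a local bound on one partial derivative. *)
Lemma C1_lipschitz_at (R : realType) n (f : 'rV[R]_n -> R) z :
  is_C1 f -> lipschitz_at f z.
Proof.
move=> C1f; pose L i := `|pderiv i f z| + 1.
have : \forall y \near z, forall i, `|pderiv i f y| <= L i.
  apply: (@filter_forall _ _ (fun i y => `|pderiv i f y| <= L i)
    (nbhs z) _) => i.
  have [_ /(_ z) ci] := C1f i.
  have /ci : nbhs (pderiv i f z) (ball (pderiv i f z) 1) by exact: nbhsx_ballx.
  move=> /nbhs_ballP[e e0 He]; apply/nbhs_ballP; exists e => // y /He.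
  rewrite /ball/= /L => yz.
  rewrite -[pderiv i f y](subrK (pderiv i f z)) distrC in yz *.
  rewrite subrK in yz; apply: le_trans (ler_normD _ _) _.
  by rewrite addrC lerD2l ltW.
move=> /nbhs_ballP[r /= r0 rL]; exists (\sum_i L i), r.
have L0 i : 0 <= L i by rewrite addr_ge0.
split => // [|u v [_ zu] [_ zv]]; first exact: sumr_ge0.
pose w k : 'rV[R]_n := \row_i if (i < k)%N then u ord0 i else v ord0 i.
have -> : f u - f v = \sum_(0 <= k < n) (f (w k.+1) - f (w k)).
  rewrite telescope_sumr//; congr (f _ - f _); apply/rowP => i; rewrite mxE//.
  by rewrite ltn_ord.
rewrite big_mkord mulr_suml; apply: le_trans (ler_norm_sum _ _ _) _.
apply: ler_sum => k _.
apply: le_trans (ler_wpM2l (L0 k) (coord_le_norm (u - v) k)).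
have -> : w k.+1 = (u - v) ord0 k *: delta_mx ord0 k + w k.
  apply/rowP => i; rewrite !mxE eqxx/= ltnS leq_eqVlt.
  have [->|ik] := eqVneq i k; first by rewrite ltnn eqxx/=; ring.
  by rewrite mulr0 add0r val_eqE (negbTE ik).
have [dk _] := C1f k.
apply: (line_lipschitz dk) => h; rewrite ge_min le_max !mxE => hb.
apply: rL; split => // i j; rewrite (ord1 i) !mxE eqxx/=.
have := zu ord0 k; have := zv ord0 k; rewrite /ball/= !ltr_norml.
have [jk|jk] := eqVneq j k; last first.
  move=> _ _; rewrite mulr0 add0r; have := zu ord0 j; have := zv ord0 j.
  by rewrite /ball/= !ltr_norml => ? ?; case: ifP.
rewrite jk ltnn mulr1 => /andP[? ?] /andP[? ?].
by case/andP: hb => /orP[?|?] /orP[?|?]; apply/andP; split; lra.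
Qed.

Lemma lipschitz_atB (R : realType) n (f g : 'rV[R]_n -> R) z :
  lipschitz_at f z -> lipschitz_at g z -> lipschitz_at (fun x => f x - g x) z.
Proof.
move=> [L [r [L0 r0 fL]]] [M [s [M0 s0 gM]]]; exists (L + M), (Num.min r s).
split; [exact: addr_ge0|by rewrite lt_min r0|move=> u v zu zv].
have mr : Num.min r s <= r by rewrite ge_min lexx.
have ms : Num.min r s <= s by rewrite ge_min lexx orbT.
have := fL u v (le_ball mr zu) (le_ball mr zv).
have := gM u v (le_ball ms zu) (le_ball ms zv).
move=> g1 f1; rewrite mulrDl.
rewrite (_ : _ - _ = (f u - f v) - (g u - g v)); last by ring.
by apply: le_trans (ler_normB _ _) _; exact: lerD.
Qed.

Lemma lipschitz_atZ (R : realType) n (c : R) (f : 'rV[R]_n -> R) z :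
  lipschitz_at f z -> lipschitz_at (fun x => c * f x) z.
Proof.
move=> [L [r [L0 r0 fL]]]; exists (`|c| * L), r; split => //.
  by rewrite mulr_ge0.
by move=> u v zu zv; rewrite -mulrBr normrM -mulrA ler_wpM2l// fL.
Qed.

(** Near [z], [g] is at least [g z / 2] and [f] is bounded, and
    a/b - a'/b' = (a - a')/b + a' (b' - b)/(b b'). *)
Lemma lipschitz_at_div (R : realType) n (f g : 'rV[R]_n -> R) z : 0 < g z ->
  lipschitz_at f z -> lipschitz_at g z -> lipschitz_at (fun x => f x / g x) z.
Proof.
move=> gz [L [r [L0 r0 fL]]] [M [s [M0 s0 gM]]].
pose c := g z / 2; have c0 : 0 < c by rewrite divr_gt0.
pose q := Num.min (c / (M + 1)) (Num.min r s).
have M1 : 0 < M + 1 by rewrite ltr_wpDl.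
have q0 : 0 < q by rewrite !lt_min r0 s0 divr_gt0.
have qr : q <= r by rewrite !ge_min lexx orbT.
have qs : q <= s by rewrite !ge_min lexx !orbT.
have qc : M * q <= c.
  apply: (@le_trans _ _ (M * (c / (M + 1)))).
    by rewrite ler_wpM2l// ge_min lexx.
  by rewrite mulrA ler_pdivrMr// mulrDr mulr1 mulrC lerDl ltW.
have dist u : ball z q u -> `|u - z| <= q.
  by rewrite mx_norm_ball /ball_/= distrC => /ltW.
have gl u : ball z q u -> c <= g u.
  move=> zu; have := gM u z (le_ball qs zu) (ballxx _ s0).
  move=> /le_trans/(_ (ler_wpM2l M0 (dist _ zu)))/le_trans/(_ qc).
  by rewrite ler_norml /c => /andP[+ _]; lra.
have fl u : ball z q u -> `|f u| <= `|f z| + L * q.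
  move=> zu; have := fL u z (le_ball qr zu) (ballxx _ r0).
  move=> /le_trans/(_ (ler_wpM2l L0 (dist _ zu))) H.
  by rewrite -[f u](subrK (f z)) addrC (le_trans (ler_normD _ _))// lerD2l.
pose B := `|f z| + L * q.
have B0 : 0 <= B by rewrite addr_ge0// mulr_ge0// ltW.
exists (L / c + B * M / c ^+ 2), q; split => //.
  by rewrite addr_ge0// divr_ge0// ?mulr_ge0// ?exprn_ge0// ltW.
move=> u v zu zv.
have := gl _ zu; have := gl _ zv; have := fl _ zv; rewrite -/B.
have := fL _ _ (le_ball qr zu) (le_ball qr zv).
have := gM _ _ (le_ball qs zu) (le_ball qs zv).
set D := `|u - v|.
move: (f u) (f v) (g u) (g v) => a a' b b' gD fD a'B cb' cb.
have b0 : 0 < b by exact: lt_le_trans cb.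
have b'0 : 0 < b' by exact: lt_le_trans cb'.
have -> : a / b - a' / b' = (a - a') / b + a' * (b' - b) / (b * b').
  by field; rewrite !gt_eqF.
have D0 : 0 <= D by exact: normr_ge0.
have ib : `|b^-1| <= c^-1 by rewrite gtr0_norm ?invr_gt0// lef_pV2.
have ibb : `|(b * b')^-1| <= (c ^+ 2)^-1.
  rewrite gtr0_norm ?invr_gt0 ?mulr_gt0//.
  rewrite lef_pV2 ?posrE ?mulr_gt0// ?exprn_gt0//.
  by rewrite expr2 ler_pM// ltW.
apply: le_trans (ler_normD _ _) _; rewrite [leRHS]mulrDl; apply: lerD.
  by rewrite normrM mulrAC ler_pM.
rewrite normrM normrM [leRHS]mulrAC ler_pM ?mulr_ge0//.
by rewrite -mulrA ler_pM// distrC.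
Qed.

Lemma pderiv_ln (R : realType) n (q : 'rV[R]_n -> R) (i : 'I_n) x : 0 < q x ->
  derivable q x (delta_mx ord0 i) ->
  pderiv i (fun y => ln (q y)) x = pderiv i q x / q x.
Proof.
set e := delta_mx _ _ => qx dq; rewrite /pderiv -/e.
have x0 : x = 0 *: e + x by rewrite scale0r add0r.
rewrite {1}x0 -derive_line.
have dg : is_derive (0 : R) (1 : R) (fun k => q (k *: e + x)) ('D_e q x).
  by rewrite {2}x0; apply: is_derive_line; rewrite -x0.
have dl : is_derive (q (0 *: e + x)) (1 : R) (@ln R) (q x)^-1.
  by rewrite -x0; exact: is_derive1_ln.
have [_ ->] := is_derive1_comp dl dg.
by rewrite mulrC.
Qed.

(** The i-th coordinate of the drift is sigma^2 (d_i q)/q - mu_i, where q, d_i q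
    and mu_i are C^1. *)
Lemma fk_drift_lipschitz_at (R : realType) n (mu : 'rV[R]_n -> 'rV[R]_n)
    (sigma : R) (q : 'rV[R]_n -> R) (i : 'I_n) z :
  is_C1_field mu -> is_C2 q -> (forall x, 0 < q x) ->
  lipschitz_at (fun x => fk_drift mu sigma q x ord0 i) z.
Proof.
move=> mu1 [q1 q2] q0.
rewrite (_ : (fun x => _) = fun x =>
    sigma ^+ 2 * (pderiv i q x / q x) - mu x ord0 i).
  apply: lipschitz_atB; last exact: C1_lipschitz_at.
  by apply: lipschitz_atZ; apply: lipschitz_at_div; rewrite ?q0//;
    exact: C1_lipschitz_at.
apply/funext => x; rewrite /fk_drift !mxE pderiv_ln//.
by have [dq _] := q1 i; exact: dq.
Qed.

(** The drift only depends on the germ of the density at the point. *)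
Lemma fk_drift_eq_on_open (R : realType) n (mu : 'rV[R]_n -> 'rV[R]_n)
    (sigma : R) (q q' : 'rV[R]_n -> R) (U : set 'rV[R]_n) : open U ->
  (forall x, U x -> q x = q' x) ->
  forall x, U x -> fk_drift mu sigma q x = fk_drift mu sigma q' x.
Proof.
move=> oU qq' x Ux; rewrite /fk_drift; congr (_ *: _ - _).
apply/rowP => i; rewrite !mxE; apply: near_eq_derive.
have : nbhs x U by exact: (open_nbhs_nbhs (conj oU Ux)).
by move=> /nbhs_ballP[e e0 eU]; apply/nbhs_ballP; exists e => // y /eU/qq' ->.
Qed.

(** A Lipschitz estimate between the values of two vector fields; at [u = v] it
    forces them to be equal near [z].  It holds where a locally Lipschitz field
    agrees with another one, and it is symmetric in the two fields, so that
    the comparison of paths below can be used in both directions. *)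
Definition lipschitz_pair_at (R : realType) n (b b' : 'rV[R]_n -> 'rV[R]_n) z :=
  exists L r, [/\ 0 <= L, 0 < r & forall u v, ball z r u -> ball z r v ->
    `|b u - b' v| <= L * `|u - v|].

Lemma lipschitz_pair_atC (R : realType) n (b b' : 'rV[R]_n -> 'rV[R]_n) z :
  lipschitz_pair_at b b' z -> lipschitz_pair_at b' b z.
Proof.
move=> [L [r [L0 r0 bL]]]; exists L, r; split => // u v zu zv.
by rewrite distrC (distrC u) bL.
Qed.

Lemma lipschitz_pair_at_open (R : realType) n (b b' : 'rV[R]_n -> 'rV[R]_n)
    (U : set 'rV[R]_n) z : open U -> (forall x, U x -> b x = b' x) -> U z ->
  (forall i, lipschitz_at (fun x => b x ord0 i) z) ->
  lipschitz_pair_at b b' z.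
Proof.
move=> oU bb' Uz /choice[L] /choice[r] Lr.
have [e /= e0 eU] : nbhs_ball z U.
  by apply/nbhs_ballP; exact: (open_nbhs_nbhs (conj oU Uz)).
exists (\sum_i L i), (\big[Num.min/e]_i r i).
have L0 i : 0 <= L i by have [] := Lr i.
split; first exact: sumr_ge0.
  apply: (big_ind (fun x : R => 0 < x)) => // [a c a0 c0|i _].
    by rewrite lt_min a0.
  by have [] := Lr i.
move=> u v zu zv; rewrite -bb'; last exact/eU/(le_ball _ zv)/bigmin_le_id.
apply: norm_le_coord => [|i]; first by rewrite mulr_ge0// sumr_ge0.
rewrite !mxE; have [_ _ /(_ u v)] := Lr i.
have rb : \big[Num.min/e]_i r i <= r i by exact: bigmin_le.
move=> /(_ (le_ball rb zu) (le_ball rb zv)) /le_trans; apply.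
by rewrite ler_wpM2r// (bigD1 i)//= lerDl sumr_ge0.
Qed.

(** * Pathwise uniqueness up to the exit time *)

Lemma Rintegral_bound_after (R : realType) (g : R -> R) (tau c M : R) :
  0 <= tau <= c -> (@lebesgue_measure R).-integrable `[0, c] (EFin \o g) ->
  (forall s, 0 <= s <= tau -> g s = 0) ->
  (forall s, tau <= s <= c -> `|g s| <= M) ->
  `|\int[@lebesgue_measure R]_(s in `[0, c]) g s| <= (c - tau) * M.
Proof.
move=> /andP[tau0 tauc] ig g0 gM.
have sub : `]tau, c]%classic `<=` (`[0, c]%classic : set R).
  by move=> s; rewrite /= !in_itv/= => /andP[/ltW /(le_trans tau0)-> ->].
have ig2 : (@lebesgue_measure R).-integrable `]tau, c] (EFin \o g).
  exact: integrableS ig.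
have := @Rintegral_itvB R g (BLeft 0) (BRight c) tau ig.
rewrite !bnd_simp => /(_ tau0 tauc).
have -> : \int[@lebesgue_measure R]_(s in `[0, tau]) g s = 0.
  rewrite (eq_Rintegral _ (g := cst 0)) ?Rintegral_cst ?mul0r// => s.
  by rewrite inE/= in_itv/=; exact: g0.
rewrite subr0 => ->.
apply: le_trans (le_normr_Rintegral _ ig2) _ => //.
have mE : fine (lebesgue_measure (`]tau, c]%classic : set R)) = c - tau.
  rewrite lebesgue_measure_itv/= lte_fin; case: ltP => //= ctau.
  by apply/esym/eqP; rewrite subr_eq0 eq_le ctau tauc.
rewrite mulrC -mE -Rintegral_cst//; apply: le_Rintegral => //.
- by have := integrable_norm ig2.
- apply: measurable_bounded_integrable => //.
  + suff: (lebesgue_measure (`]tau, c]%classic : set R) < +oo)%E by [].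
    rewrite lebesgue_measure_itv/= lte_fin; case: ifP => _ //.
    by rewrite -EFinB ltry.
  + exact: bounded_cst.
- move=> s; rewrite /= in_itv/= => /andP[/ltW ts sc].
  by rewrite gM// ts.
Qed.

(** Let tau be the infimum of the times at which the paths differ.  They agree
    up to tau, and at tau by continuity.  On a short interval after tau both
    paths are in a ball where the fields satisfy a Lipschitz estimate with
    constant L; the maximum M of |x - y| on this interval satisfies
    M <= (length of the interval) L M, so M = 0 if the length is at most 1/(2L),
    against the choice of tau.  The hypothesis that the path stays in [Om] is
    made for [x] alone, since [y] equals [x] up to tau. *)
Lemma ode_unique_while_inside (R : realType) n (b b' : 'rV[R]_n -> 'rV[R]_n)
    (Om : set 'rV[R]_n) (x y : R -> 'rV[R]_n) (t : R) :
  (forall z, Om z -> lipschitz_pair_at b b' z) ->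
  {within `[0, t], continuous x} -> {within `[0, t], continuous y} ->
  x 0 = y 0 ->
  (forall i, (@lebesgue_measure R).-integrable `[0, t]
     (fun s => (b (x s) ord0 i)%:E)) ->
  (forall i, (@lebesgue_measure R).-integrable `[0, t]
     (fun s => (b' (y s) ord0 i)%:E)) ->
  (forall s, 0 <= s <= t -> forall i, x s ord0 i - y s ord0 i =
     \int[@lebesgue_measure R]_(r in `[0, s]) (b (x r) ord0 i)
   - \int[@lebesgue_measure R]_(r in `[0, s]) (b' (y r) ord0 i)) ->
  (forall s, 0 <= s <= t -> Om (x s)) ->
  forall s, 0 <= s <= t -> x s = y s.
Proof.
move=> lipb cx cy xy0 ib ib' xyE xO s1 /andP[s10 s1t].
have bb' z : Om z -> b z = b' z.
  move=> /lipb[L [r [_ r0 /(_ z z)]]] H.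
  apply/eqP; rewrite -subr_eq0 -normr_le0.
  have := H (ballxx _ r0) (ballxx _ r0).
  by rewrite subrr normr0 mulr0.
apply: contrapT => /eqP s1xy.
pose B := [set s | (0 <= s <= t) && (x s != y s)].
have B1 : B s1 by rewrite /B /= s10 s1t.
have hB : has_inf B.
  by split; [exists s1|exists 0 => s /andP[/andP[]]].
pose tau := inf B.
have tau0 : 0 <= tau by apply: lb_le_inf => [|s /andP[/andP[]]//]; exists s1.
have taus1 : tau <= s1 by apply: ge_inf => //; case: hB.
have taut : tau <= t by exact: le_trans s1t.
have before s : 0 <= s < tau -> x s = y s.
  move=> /andP[s0 st]; apply/eqP/negPn/negP => xys.
  have : tau <= s.
    apply: ge_inf; first by case: hB.
    by rewrite /B /= s0 xys (le_trans (ltW st)).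
  by rewrite leNgt st.
have tau0t : 0 <= tau <= t by rewrite tau0.
have xytau : x tau = y tau.
  apply/eqP/negPn/negP => ne.
  have e0 : 0 < `|x tau - y tau| / 2 by rewrite divr_gt0// normr_gt0 subr_eq0.
  have [d1 d10 H1] := within_continuous_ball cx tau0t e0.
  have [d2 d20 H2] := within_continuous_ball cy tau0t e0.
  have [tau00|tau00] := eqVneq tau 0; first by rewrite tau00 xy0 eqxx in ne.
  have taup : 0 < tau by rewrite lt_neqAle eq_sym tau00.
  pose d := Num.min tau (Num.min d1 d2) / 2.
  have D0 : 0 < d by rewrite divr_gt0// !lt_min taup d10.
  have D1 : d * 2 <= tau by rewrite divfK// ge_min lexx.
  have D2 : d * 2 <= d1 by rewrite divfK// !ge_min lexx orbT.
  have D3 : d * 2 <= d2 by rewrite divfK// !ge_min lexx !orbT.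
  move: d D0 D1 D2 D3 => d dp dd2 dd1 dtau.
  have dt : 0 <= tau - d <= t by apply/andP; split; lra.
  have dE : `|tau - (tau - d)| = d by rewrite opprB addrC subrK gtr0_norm.
  have {}H1 : ball (x tau) (`|x tau - y tau| / 2) (x (tau - d)).
    by apply: H1 => //; rewrite dE; lra.
  have {}H2 : ball (y tau) (`|x tau - y tau| / 2) (y (tau - d)).
    by apply: H2 => //; rewrite dE; lra.
  rewrite -(before (tau - d)) in H2; last by apply/andP; split; lra.
  have := ball_triangle H1 (ball_sym H2).
  by rewrite -splitr mx_norm_ball /ball_/= ltxx.
have upto s : 0 <= s <= tau -> x s = y s.
  move=> /andP[s0]; rewrite le_eqVlt => /predU1P[->//|st].
  by apply: before; rewrite s0.
have [L [r [L0 r0 Lr]]] := lipb _ (xO _ tau0t).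
have [d1 d10 H1] := within_continuous_ball cx tau0t r0.
have [d2 d20 H2] := within_continuous_ball cy tau0t r0.
(* [eta * L <= 1/2] and [eta < d1, d2]; [L + 1] avoids dividing by L = 0. *)
pose eta := Num.min (L + 1)^-1 (Num.min d1 d2) / 2.
have eta0 : 0 < eta by rewrite divr_gt0// !lt_min invr_gt0 ltr_wpDl// d10.
have etaL : eta * L <= 2^-1.
  apply: (@le_trans _ _ ((L + 1)^-1 / 2 * L)).
    by rewrite ler_wpM2r// ler_wpM2r// ge_min lexx.
  have L1 : 0 < L + 1 by rewrite ltr_wpDl.
  by rewrite mulrAC ler_piMl// mulrC ler_pdivrMr// mul1r; lra.
have eta1 : eta * 2 <= d1 by rewrite divfK// !ge_min lexx orbT.
have eta2 : eta * 2 <= d2 by rewrite divfK// !ge_min lexx !orbT.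
have [s2 + s2tau] := inf_adherent eta0 hB; rewrite -/tau in s2tau.
move=> /[dup] B2 /andP[/andP[s20 s2t] s2xy].
have taus2 : tau <= s2 by apply: ge_inf => //; case: hB.
have cnorm : {within `[tau, s2], continuous (fun s => `|x s - y s|)}.
  apply/subspace_continuousP => s; rewrite /= in_itv/= => /andP[ts ss2].
  have st : `[0, t]%classic s.
    by rewrite /= in_itv/= (le_trans tau0 ts) (le_trans ss2).
  have sub : `[tau, s2]%classic `<=` (`[0, t]%classic : set R).
    by move=> u; rewrite /= !in_itv/= => /andP[/(le_trans tau0)-> /le_trans ->].
  move/subspace_continuousP : cx => /(_ s st) cx.
  move/subspace_continuousP : cy => /(_ s st) cy.
  apply: cvg_norm; apply: cvg_trans (cvgB cx cy).
  by apply: cvg_app; apply: within_subset.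
have [c /[!in_itv]/= /andP[tauc cs2] cmax] := EVT_max taus2 cnorm.
set M := `|x c - y c| in cmax.
have cball s : tau <= s <= c -> ball (x tau) r (x s) /\ ball (x tau) r (y s).
  move=> /andP[ts sc].
  have st : 0 <= s <= t by apply/andP; split; lra.
  have sd : `|tau - s| <= eta by rewrite distrC ger0_norm; lra.
  split; first by apply: H1 => //; lra.
  by rewrite xytau; apply: H2 => //; lra.
have ct : 0 <= c <= t by apply/andP; split; lra.
have sub : `[0, c]%classic `<=` (`[0, t]%classic : set R).
  by move=> s; rewrite /= !in_itv/= => /andP[-> /le_trans ->]//; case/andP: ct.
have ibc i : (@lebesgue_measure R).-integrable `[0, c]
     (EFin \o (fun s => b (x s) ord0 i)) by exact: integrableS (ib i).
have ibc' i : (@lebesgue_measure R).-integrable `[0, c]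
     (EFin \o (fun s => b' (y s) ord0 i)) by exact: integrableS (ib' i).
have MM : M <= (c - tau) * (L * M).
  apply: (@norm_le_coord _ _ _ ((c - tau) * (L * M))) => [|i].
    by rewrite mulr_ge0 ?subr_ge0// mulr_ge0// normr_ge0.
  rewrite !mxE xyE// -RintegralB//.
  apply: Rintegral_bound_after.
  - by rewrite tau0.
  - rewrite (_ : _ \o _ = (EFin \o (fun s => b (x s) ord0 i)) \-
      (EFin \o (fun s => b' (y s) ord0 i)))%E//.
    by apply: integrableB.
  - move=> s /[dup] stau /upto <-; rewrite bb' ?subrr//; apply: xO.
    by case/andP: stau => -> /le_trans->.
  - move=> s /[dup] /cball[? ?] /andP[taus sc].
    have := coord_le_norm (b (x s) - b' (y s)) i.
    rewrite !mxE => /le_trans; apply.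
    apply: le_trans (Lr _ _ _ _) _ => //; rewrite ler_wpM2l//.
    by apply: cmax; rewrite in_itv/= taus (le_trans sc).
have M0 : 0 <= M by exact: normr_ge0.
have : M <= 2^-1 * M.
  apply: le_trans MM _; rewrite mulrA ler_wpM2r//.
  by apply: le_trans etaL; rewrite ler_wpM2r//; lra.
have : `|x s2 - y s2| <= M by apply: cmax; rewrite in_itv/= taus2 lexx.
have : 0 < `|x s2 - y s2| by rewrite normr_gt0 subr_eq0.
by lra.
Qed.

(** * Two diffusions driven by the same Brownian motion *)

Section coupled_processes.
Context (R : realType) (n : nat) dS (S : measurableType dS).
Variables (P : probability S R).
Implicit Types (X Y W : R -> S -> 'rV[R]_n) (b : 'rV[R]_n -> 'rV[R]_n).

(** The diffusion coefficient is constant, so the stochastic terms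
    sigma (W_t - W_0) of the two integral equations are equal and the difference
    of the two paths only involves the integrals of the drifts. *)
Lemma sde_solution_unique_while_inside T b b' sigma x W X Y (Om : set 'rV[R]_n) :
  (forall z, Om z -> lipschitz_pair_at b b' z) ->
  sde_solution P T b sigma x W X -> sde_solution P T b' sigma x W Y ->
  {ae P, forall w, forall t, 0 <= t <= T -> stays_in Om X t w ->
    forall s, 0 <= s <= t -> X s w = Y s w}.
Proof.
move=> lipb [F [_ _ _ cX]] aeX [G [_ _ _ cY]] aeY.
move: aeX aeY; apply: filterS2 => w [X0 iX eX] [Y0 iY eY] t /andP[t0 tT] XO.
have sub : `[0, t]%classic `<=` (`[0, T]%classic : set R).
  by move=> s; rewrite /= !in_itv/= => /andP[-> /le_trans ->].
apply: (ode_unique_while_inside lipb) => //.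
- exact: continuous_subspaceW (cX w).
- exact: continuous_subspaceW (cY w).
- by rewrite X0.
- by move=> i; apply: integrableS (iX i).
- by move=> i; apply: integrableS (iY i).
- move=> s /andP[s0 st] i; have sT : 0 <= s <= T by rewrite s0 (le_trans st).
  by rewrite eX// eY//; ring.
Qed.

Lemma measurable_stays_in_sde T b sigma x W X (Om : set 'rV[R]_n) t :
  open Om -> 0 <= t <= T -> sde_solution P T b sigma x W X ->
  measurable (stays_in Om X t).
Proof.
move=> oO /andP[t0 tT] [F [[_ Fm _] _ adX cX _]].
apply: measurable_stays_in => // [s /andP[s0 st]|w].
  move=> _ A mA; rewrite setTI; apply: (Fm s s0); apply: adX => //.
  by rewrite /= in_itv/= s0 (le_trans st).
apply: continuous_subspaceW (cX w).
by move=> s; rewrite /= !in_itv/= => /andP[-> /le_trans ->].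
Qed.

Lemma integral_ae_eq_sets (E E' : set S) (f f' : S -> R) :
  measurable E -> measurable E' ->
  P.-integrable [set: S] (EFin \o f) -> P.-integrable [set: S] (EFin \o f') ->
  {ae P, forall w, (E w <-> E' w) /\ (E w -> f w = f' w)} ->
  (\int[P]_(w in E) (f w)%:E = \int[P]_(w in E') (f' w)%:E)%E.
Proof.
move=> mE mE' fi fi' ae.
rewrite [LHS]integral_mkcond [RHS]integral_mkcond.
apply: ae_eq_integral => //.
- apply: (measurable_int P); rewrite -integrable_mkcond//.
  exact: integrableS fi.
- apply: (measurable_int P); rewrite -integrable_mkcond//.
  exact: integrableS fi'.
apply: filterS ae => w [EE' ff'] _; rewrite /patch.
have -> : (w \in E') = (w \in E) by apply/idP/idP; rewrite !inE => /EE'.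
by case: ifPn => // /set_mem /ff' /= ->.
Qed.

(** [E] and [E'] are the events of not having exited.  The integrals of [h] over
    [E] and of [h'] over [E'] cancel; the integrals over the complements, times
    [q], are both in [0, K P(~E)], and so differ by at most the length of that
    interval. *)
Lemma expectation_diff_le_exit (E E' : set S) (h h' : S -> R) (q K : R) :
  measurable E -> measurable E' ->
  P.-integrable [set: S] (EFin \o h) -> P.-integrable [set: S] (EFin \o h') ->
  (forall w, 0 <= h w) -> (forall w, 0 <= h' w) -> 0 < q -> 0 < K ->
  {ae P, forall w, (E w <-> E' w) /\ (E w -> h w = h' w)} ->
  ((0 < P (~` E))%E -> (q%:E * event_expectation P (~` E) h < K%:E)%E) ->
  ((0 < P (~` E'))%E -> (q%:E * event_expectation P (~` E') h' < K%:E)%E) ->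
  (`|q%:E * (\int[P]_w (h' w)%:E) - q%:E * (\int[P]_w (h w)%:E)|
    <= K%:E * P (~` E))%E.
Proof.
move=> mE mE' ih ih' h0 h'0 q0 K0 ae hK h'K.
have PE : P (~` E) = P (~` E').
  have mEc := measurableC mE; have mE'c := measurableC mE'.
  rewrite -[P (~` E)]mul1e -[P (~` E')]mul1e -!integral_cst//.
  apply: (@integral_ae_eq_sets _ _ (cst 1) (cst 1)) => //.
  - exact: finite_measure_integrable_cst.
  - exact: finite_measure_integrable_cst.
  by apply: filterS ae => w [EE' _]; split => //; rewrite /setC /=; tauto.
have split_int : forall (A : set S) (f : S -> R), measurable A ->
    P.-integrable [set: S] (EFin \o f) -> (\int[P]_w (f w)%:E =
    \int[P]_(w in A) (f w)%:E + \int[P]_(w in ~` A) (f w)%:E)%E.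
  move=> A f mA fi; rewrite -integral_setU ?setUv//; first exact: measurableC.
    exact: (measurable_int P).
  by apply/disj_setPCl.
have bound : forall (A : set S) (f : S -> R), measurable A ->
    P.-integrable [set: S] (EFin \o f) -> (forall w, 0 <= f w) ->
    ((0 < P (~` A))%E -> (q%:E * event_expectation P (~` A) f < K%:E)%E) ->
    exists2 u, (\int[P]_(w in ~` A) (f w)%:E)%E = u%:E &
      0 <= q * u <= K * fine (P (~` A)).
  move=> A f mA fi f0 fK; have mAc := measurableC mA.
  have fAi : P.-integrable (~` A) (EFin \o f) by exact: integrableS fi.
  have Pfin : P (~` A) \is a fin_num by exact: fin_num_measure.
  have [P0|P0] := eqVneq (P (~` A)) 0%E.
    exists 0; last by rewrite P0 /= !mulr0 lexx.
    by rewrite null_set_integral//; exact: (measurable_int P).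
  exists (fine (\int[P]_(w in ~` A) (f w)%:E)%E).
    by rewrite fineK// integrable_fin_num.
  apply/andP; split.
    apply: mulr_ge0 (ltW q0) _; apply: fine_ge0; apply: integral_ge0 => w _.
    by rewrite lee_fin.
  have {}P0 : (0 < P (~` A))%E by rewrite lt0e P0 measure_ge0.
  move: P0 (fK P0); rewrite /event_expectation.
  rewrite -(fineK (integrable_fin_num mAc fAi)) -(fineK Pfin).
  move: (fine _) (fine (P _)) => u p /=; rewrite lte_fin => p0.
  by rewrite inver gt_eqF// lte_fin mulrA ltr_pdivrMr// => /ltW.
have [u uE /andP[u0 uK]] := bound _ _ mE ih h0 hK.
have [v vE /andP[v0 vK]] := bound _ _ mE' ih' h'0 h'K.
rewrite (split_int _ _ mE ih) (split_int _ _ mE' ih') uE vE.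
rewrite -(integral_ae_eq_sets mE mE' ih ih'); last first.
  by apply: filterS ae => w [EE' hh']; split => // /hh'.
have fE : (\int[P]_(w in E) (h w)%:E)%E \is a fin_num.
  by apply: integrable_fin_num => //; exact: integrableS ih.
rewrite -(fineK fE); move: (fine _) => a.
have := fin_num_measure P _ (measurableC mE) => /fineK <-.
rewrite -PE in vK; move: (fine _) uK vK => p uK vK.
rewrite [leLHS](_ : _ = (`|q * (a + v) - q * (a + u)|)%:E)// lee_fin.
by rewrite ler_norml; apply/andP; split; lra.
Qed.
End coupled_processes.

(** * Averaging over the starting point *)

Section lower_integral.
Local Open Scope ereal_scope.
Context d (T : measurableType d) (R : realType).
Variables (mu : {measure set T -> \bar R}) (D : set T).
Implicit Types f g k : T -> \bar R.

Import HBNNSimple.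

Let sintegral_le_integral f (h : {nnsfun T >-> R}) :
  (forall x, D x -> 0 <= f x) -> (forall x, (h x)%:E <= (f \_ D) x) ->
  sintegral mu h <= \int[mu]_(x in D) f x.
Proof.
by move=> f0 hf; rewrite ge0_integralE//; apply: ereal_sup_ubound; exists h.
Qed.

Let integral_le_sintegral f M : (forall x, D x -> 0 <= f x) ->
  (forall h : {nnsfun T >-> R}, (forall x, (h x)%:E <= (f \_ D) x) ->
    sintegral mu h <= M) ->
  \int[mu]_(x in D) f x <= M.
Proof.
move=> f0 H; rewrite ge0_integralE//; apply: ge_ereal_sup => _ [h hf <-].
exact: H.
Qed.

(** The sum of a simple function below [f] and one below [g] is a simple
    function below [k].  The integrals are lower integrals, for which this
    inequality can be strict. *)
Lemma lower_integral_superadditive f g k :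
  (forall x, D x -> 0 <= f x) -> (forall x, D x -> 0 <= g x) ->
  (forall x, D x -> f x + g x <= k x) ->
  \int[mu]_(x in D) f x + \int[mu]_(x in D) g x <= \int[mu]_(x in D) k x.
Proof.
move=> f0 g0 fgk; have k0 x : D x -> 0 <= k x.
  by move=> Dx; apply: le_trans (fgk x Dx); rewrite adde_ge0 ?f0 ?g0.
have [->|koo] := eqVneq (\int[mu]_(x in D) k x) +oo; first exact: leey.
have add (h1 h2 : {nnsfun T >-> R}) : (forall x, (h1 x)%:E <= (f \_ D) x) ->
    (forall x, (h2 x)%:E <= (g \_ D) x) ->
    sintegral mu h1 + sintegral mu h2 <= \int[mu]_(x in D) k x.
  move=> h1f h2g; rewrite -sintegralD//.
  apply: (sintegral_le_integral (h := add_nnsfun h1 h2)) => // x.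
  apply: le_trans (leeD (h1f x) (h2g x)) _; rewrite /patch.
  by case: ifPn => [/set_mem /fgk//|_]; rewrite adde0.
have finle a : 0 <= a -> a <= \int[mu]_(x in D) k x -> a \is a fin_num.
  move=> a0 ak; rewrite ge0_fin_numE//; apply: le_lt_trans ak _.
  by rewrite ltey.
have h0 : forall x, (nnsfun0 x : R)%:E <= (f \_ D) x.
  by move=> x; rewrite /patch; case: ifPn => [/set_mem /f0//|].
have gfin : \int[mu]_(x in D) g x \is a fin_num.
  apply: finle; first exact: integral_ge0.
  apply: integral_le_sintegral => // h hg.
  by have := add nnsfun0 h h0 hg; rewrite sintegral0 add0e.
rewrite -leeBrDr//; apply: integral_le_sintegral => // h1 h1f.
have h1fin : sintegral mu h1 \is a fin_num.
  apply: finle; first exact: sintegral_ge0.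
  apply: sintegral_le_integral => // x; apply: le_trans (h1f x) _.
  rewrite /patch; case: ifPn => // /set_mem Dx.
  by apply: le_trans (fgk _ Dx); rewrite leeDl// g0.
rewrite leeBrDr// -leeBrDl//; apply: integral_le_sintegral => // h2 h2g.
by rewrite leeBrDl//; exact: add.
Qed.

Lemma lower_integralZ_ge f (c : R) : (0 < c)%R -> (forall x, D x -> 0 <= f x) ->
  c%:E * \int[mu]_(x in D) f x <= \int[mu]_(x in D) (c%:E * f x).
Proof.
move=> c0 f0; rewrite -lee_pdivlMl//; apply: integral_le_sintegral => // h hf.
rewrite lee_pdivlMl// -sintegralrM.
apply: (sintegral_le_integral (h := scale_nnsfun h (ltW c0))) => [x Dx|x].
  by rewrite mule_ge0 ?f0// lee_fin ltW.
apply: (@le_trans _ _ (c%:E * (f \_ D) x)).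
  by rewrite [leLHS]EFinM lee_pmul2l// ?lte_fin//; exact: hf.
by rewrite /patch; case: ifPn; rewrite ?mule0.
Qed.

End lower_integral.

(** Superadditivity applied to g + K f <= K gives
    int g <= K (|D| - int f) < K eps |D|.  If |D| is 0 or infinite, the
    conventions for division make the average of [g] vanish. *)
Lemma uniform_expectation_lt (R : realType) n (D : set 'rV[R]_n)
    (f g : 'rV[R]_n -> \bar R) (K eps : R) : measurable D -> 0 < K -> 0 < eps ->
  (forall x, D x -> 0 <= f x)%E -> (forall x, D x -> 0 <= g x)%E ->
  (forall x, D x -> g x + K%:E * f x <= K%:E)%E ->
  ((1 - eps)%:E < uniform_expectation D f)%E ->
  (uniform_expectation D g < (2 * K * eps)%:E)%E.
Proof.
move=> mD K0 eps0 f0 g0 gf; rewrite /uniform_expectation.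
have G : (\int[lebesgue_rV n]_(x in D) g x +
    K%:E * \int[lebesgue_rV n]_(x in D) f x <= K%:E * lebesgue_rV n D)%E.
  rewrite -integral_cst//.
  have Kf0 x : D x -> (0 <= K%:E * f x)%E.
    by move=> Dx; rewrite mule_ge0 ?f0// lee_fin ltW.
  apply: le_trans (lower_integral_superadditive (lebesgue_rV n) g0 Kf0 gf).
  by rewrite leeD2l// lower_integralZ_ge.
have I0 : (0 <= \int[lebesgue_rV n]_(x in D) g x)%E by exact: integral_ge0.
have J0 : (0 <= \int[lebesgue_rV n]_(x in D) f x)%E by exact: integral_ge0.
have rhs0 : (0 < (2 * K * eps)%:E)%E by rewrite lte_fin !mulr_gt0.
have M0 : (0 <= lebesgue_rV n D)%E by exact: measure_ge0.
move: G I0 J0 M0.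
move: (\int[_]_(_ in _) g _)%E (\int[_]_(_ in _) f _)%E (lebesgue_rV n D).
move=> I J [m| |] IJ I0 J0  // m0; last by rewrite invey !mule0.
move: m0; rewrite lee_fin le_eqVlt => /predU1P[m0|m0]; last first.
  case: J J0 IJ => [J J0 IJ|_|//]; last first.
    by rewrite gt0_muley ?lte_fin// addey// -?ltNye ?(lt_le_trans _ I0).
  case: I I0 IJ => [I I0|//|//]; rewrite !lee_fin => IJ.
  rewrite inver gt_eqF// !lte_fin ltr_pdivlMr// ltr_pdivrMr// => H.
  apply: (@le_lt_trans _ _ (K * eps * m)); first by nra.
  by rewrite -!mulrA ltr_pMl ?mulr_gt0// ltr1n.
have -> : I = 0%E.
  apply/eqP; rewrite eq_le I0 andbT; move: IJ; rewrite -m0 mule0.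
  by apply: le_trans; rewrite leeDl// mule_ge0// lee_fin ltW.
by rewrite mul0e.
Qed.

(** * The error bound *)

Theorem proposition4p4 (R : realType) (d : nat)
  (mu : 'rV[R]_d -> 'rV[R]_d) (sigma : R) (p0 pinf psharp : 'rV[R]_d -> R)
  (D Omega : set 'rV[R]_d) (T eps : R)
  (dS : measure_display) (S : measurableType dS)
  (* [Pr x] is the conditional law given that the processes start at [x] *)
  (Pr : 'rV[R]_d -> probability S R) (W Xbar Xhat : R -> S -> 'rV[R]_d) :
  let phat := patch psharp Omega pinf in
  let bbar := fk_drift mu sigma pinf in
  let bhat := fk_drift mu sigma phat in
  let p t x := feynman_kac (Pr x) pinf p0 Xbar t x in
  let p_hat t x := feynman_kac (Pr x) phat p0 Xhat t x in
  let Ebar t := stays_in Omega Xbar t in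
  let Ehat t := stays_in Omega Xhat t in
  let h0 y := p0 y / pinf y in
  let h0hat y := p0 y / phat y in
  let xi := uniform_expectation D (fun x => Pr x (Ebar T)) in
  is_C1_field mu -> 0 < sigma -> is_density p0 ->
  is_C2 pinf -> (forall x, 0 < pinf x) ->
  (forall x, fokker_planck mu sigma pinf x = 0) ->
  (forall x, ~ Omega x -> 0 < psharp x) ->
  (exists x, ~ Omega x /\ psharp x <> pinf x) ->
  bounded_domain D -> bounded_domain Omega -> D `<=` Omega ->
  0 < T -> 0 < eps ->
  (forall x, D x -> sde_solution (Pr x) T bbar sigma x W Xbar) ->
  (forall x, D x -> unique_in_law T bbar sigma x) ->
  (forall x, D x -> sde_solution (Pr x) T bhat sigma x W Xhat) ->
  (forall x, D x -> unique_in_law T bhat sigma x) ->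
  (forall t x, 0 <= t <= T -> D x ->
    (Pr x).-integrable [set: S] (fun w => (h0 (Xbar t w))%:E)) ->
  (forall t x, 0 <= t <= T -> D x ->
    (Pr x).-integrable [set: S] (fun w => (h0hat (Xhat t w))%:E)) ->
  ((1 - eps)%:E < xi)%E ->
  forall K : R, 0 < K ->
  (forall t x, 0 <= t <= T -> D x ->
    ((0 < Pr x (~` Ebar t))%E ->
     ((pinf x)%:E * event_expectation (Pr x) (~` Ebar t)
                      (fun w => h0 (Xbar t w)) < K%:E)%E) /\
    ((0 < Pr x (~` Ehat t))%E ->
     ((phat x)%:E * event_expectation (Pr x) (~` Ehat t)
                      (fun w => h0hat (Xhat t w)) < K%:E)%E)) ->
  forall t, 0 <= t <= T ->
  (uniform_expectation D (fun x => `| p_hat t x - p t x |) < (2 * K * eps)%:E)%E.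
Proof.
move=> phat bbar bhat p p_hat Ebar Ehat h0 h0hat xi mu1 _ [_ p00 _].
move=> pinf2 pinf0 _ psharp0 _ [oD _ _ _] [oO _ _ _] DO T0 eps0.
move=> solbar _ solhat _ ibar ihat xi_gt K K0 bound t tT.
have phatO x : Omega x -> pinf x = phat x.
  by move=> Ox; rewrite /phat /patch mem_set.
have phat0 x : 0 < phat x.
  by rewrite /phat /patch; case: ifPn => [_|/negP]; rewrite // inE; exact: psharp0.
have pair z : Omega z -> lipschitz_pair_at bbar bhat z.
  move=> Oz; apply: (lipschitz_pair_at_open oO _ Oz) => [|i].
    exact: (fk_drift_eq_on_open mu sigma oO phatO).
  exact: fk_drift_lipschitz_at.
apply: (uniform_expectation_lt (measurable_open_rV oD) K0 eps0 _ _ _ xi_gt) => //.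
move=> x Dx; have TT : 0 <= T <= T by rewrite lexx ltW.
have mbarT := measurable_stays_in_sde oO TT (solbar x Dx).
have mbar := measurable_stays_in_sde oO tT (solbar x Dx).
have mhat := measurable_stays_in_sde oO tT (solhat x Dx).
have t0 : 0 <= t by case/andP: tT.
have same : {ae Pr x, forall w, (Ebar t w <-> Ehat t w) /\
    (Ebar t w -> h0 (Xbar t w) = h0hat (Xhat t w))}.
  have := sde_solution_unique_while_inside
    (fun z Oz => lipschitz_pair_atC (pair z Oz)) (solhat x Dx) (solbar x Dx).
  have := sde_solution_unique_while_inside pair (solbar x Dx) (solhat x Dx).
  apply: filterS2 => w /(_ t tT) bh /(_ t tT) hb; split.
    by split=> Ew s st; [rewrite -bh//|rewrite -hb//]; exact: Ew.
  move=> Ew; have tt : 0 <= t <= t by rewrite t0 lexx.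
  by rewrite -bh// /h0 /h0hat phatO//; exact: Ew.
have q0 y : 0 <= h0 y by rewrite divr_ge0// ltW.
have qhat0 y : 0 <= h0hat y by rewrite divr_ge0// ltW.
have [bK hK] := bound t x tT Dx; rewrite -(phatO x (DO x Dx)) in hK.
have := expectation_diff_le_exit mbar mhat (ibar t x tT Dx) (ihat t x tT Dx)
  (fun w => q0 _) (fun w => qhat0 _) (pinf0 x) K0 same bK hK.
rewrite /p_hat /p /feynman_kac unlock -(phatO x (DO x Dx)).
move=> /(leeD2r (K%:E * Pr x (Ebar T))%E)/le_trans; apply.
have : (Pr x (~` Ebar t) <= Pr x (~` Ebar T))%E.
  apply: le_measure; rewrite ?inE; [exact: measurableC|exact: measurableC|].
  apply: subsetC => w Ew s /andP[s0 st]; apply: Ew.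
  by rewrite s0 (le_trans st)//; case/andP: tT.
rewrite !probability_setC//.
have : Pr x (Ebar t) \is a fin_num by exact: fin_num_measure.
have : Pr x (Ebar T) \is a fin_num by exact: fin_num_measure.
move=> /fineK <- /fineK <-; move: (fine _) (fine _) => a b.
rewrite -!EFinB -!EFinM -EFinD !lee_fin => ab.
by rewrite -mulrDr ler_piMr ?(ltW K0)//; lra.
Qed.
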